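(* Let $\pi:\mathbb{S}_r^+\to\mathbb{S}_r^+$ and suppose that for all $Q\in\mathbb{S}_r^+$ $$\Gamma_\pi(Q):=(\pi(Q)-Q)S(\pi(Q)-Q)=B_0+B_1Q+QB_1'+QB_2Q+\mathcal{R}(Q)$$ for some $B_0,B_1,B_2\in\mathbb{S}_r$ with $B_2\le S$ and a symmetric remainder $\mathcal{R}(Q)$ with $\varpi:=\sup_{Q\in\mathbb{S}_r^+}\Vert\mathcal{R}(Q)\Vert_2<\infty$. Set $A_\pi:=A+B_1$, $R_\pi:=R+B_0+\varpi Id$, $S_\pi:=S-B_2$, and assume that $(A_\pi,R_\pi,S_\pi)$ satisfies the Gramian condition: for some $\upsilon_\pi>0$ and some positive constants $\varpi^{c}_\pm(\pi),\varpi^o_\pm(\pi)$, $$\varpi^c_-(\pi)Id\le\mathcal{C}_{\pi,\upsilon_\pi}\le\varpi^c_+(\pi)Id,\qquad\varpi^o_-(\pi)Id\le\mathcal{O}_{\pi,\upsilon_\pi}\le\varpi^o_+(\pi)Id .$$ Then for any $t\ge\max(\upsilon,\upsilon_\pi)$ and any $Q\in\mathbb{S}_r^+$, $$\left(\mathcal{O}_\upsilon(\mathcal{C})+\mathcal{C}_\upsilon^{-1}\right)^{-1}\le\phi_t(Q)\le\phi^\pi_t(Q)\le\phi_{\pi,t}(Q)\le\mathcal{O}_{\pi,\upsilon_\pi}^{-1}+\mathcal{C}_{\pi,\upsilon_\pi}(\mathcal{O}).$$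
   Context: Notation: $\mathbb{M}_r$ = real $r\times r$ matrices, $\mathbb{S}_r^+\subset\mathbb{S}_r$ = symmetric positive semi-definite (resp. symmetric) matrices, $\le$ = Loewner order, $'$ = transpose, $\Vert\cdot\Vert_2$ = spectral norm. Standing setting: $A\in\mathbb{M}_r$, $C$ is a real $r'\times r$ matrix, $R\in\mathbb{S}_r^+$ and $\Sigma\in\mathbb{S}_{r'}^+$ are positive definite, $S:=C'\Sigma^{-1}C$; $(A,R^{1/2})$ is controllable and $(A,C)$ is observable. $\mathrm{Ricc}(Q)=AQ+QA'-QSQ+R$. Flows (started at $Q$ at time $0$): $\phi_t(Q)$ is the flow of $\partial_tP_t=\mathrm{Ricc}(P_t)$; $\phi^\pi_t(Q)$ is the flow of $\partial_tP_t=[A-\pi(P_t)S]P_t+P_t[A-\pi(P_t)S]'+R+\pi(P_t)S\pi(P_t)=\mathrm{Ricc}(P_t)+\Gamma_\pi(P_t)$, with $\pi$ such that this equation has a unique solution; $\phi_{\pi,t}(Q)$ is the flow of $\partial_tP_t=A_\pi P_t+P_tA_\pi'+R_\pi-P_tS_\pi P_t$. Gramians of $(A,R,S)$: $\mathcal{O}_t:=\int_0^te^{-A's}Se^{-As}ds$, $\mathcal{C}_t:=\int_0^te^{As}Re^{A's}ds$, $\mathcal{C}_t(\mathcal{O}):=\mathcal{O}_t^{-1}\left[\int_0^te^{-(t-s)A'}\mathcal{O}_sR\mathcal{O}_se^{-(t-s)A}ds\right]\mathcal{O}_t^{-1}$, $\mathcal{O}_t(\mathcal{C}):=\mathcal{C}_t^{-1}\left[\int_0^te^{(t-s)A}\mathcal{C}_sS\mathcal{C}_se^{(t-s)A'}ds\right]\mathcal{C}_t^{-1}$.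 $\upsilon>0$ is a fixed interval of observability-controllability (all four Gramians of $(A,R,S)$ at time $\upsilon$ are bounded above and below by positive multiples of $Id$). $\mathcal{O}_{\pi,t},\mathcal{C}_{\pi,t},\mathcal{C}_{\pi,t}(\mathcal{O}),\mathcal{O}_{\pi,t}(\mathcal{C})$ are the same Gramians for the triplet $(A_\pi,R_\pi,S_\pi)$. *)

(* Defs.v *)
From HB Require Import structures.
From mathcomp Require Import all_boot all_order all_algebra.
From mathcomp Require Import all_classical all_reals all_analysis.

Set Implicit Arguments.
Unset Strict Implicit.
Unset Printing Implicit Defensive.

Import Order.TTheory GRing.Theory Num.Theory.
Import numFieldNormedType.Exports.

Local Open Scope classical_set_scope.
Local Open Scope ring_scope.

Section Definitions.
Context {K : realType}.

Definition psd n : set 'M[K]_n :=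
  [set M | M^T = M /\ forall x : 'cV[K]_n, 0 <= (x^T *m M *m x) 0 0].

Definition posdef n : set 'M[K]_n :=
  [set M | M^T = M /\ forall x : 'cV[K]_n, x != 0 -> 0 < (x^T *m M *m x) 0 0].

Definition loewner n (M N : 'M[K]_n) : Prop := psd (N - M).

(* [xget] selects the unique symmetric positive semi-definite root; the value
   is 0 when [M] has none, that is when [M] is not positive semi-definite. *)
Definition psd_sqrt n (M : 'M[K]_n) : 'M[K]_n :=
  xget 0 [set N | psd N /\ N *m N = M].

Definition euclidean_norm n (x : 'cV[K]_n) : K := Num.sqrt ((x^T *m x) 0 0).

(* The norm induced by the Euclidean vector norm; the library norm `|M| on
   matrices is the entrywise maximum. *)
Definition spectral_norm n (M : 'M[K]_n) : K :=
  sup [set euclidean_norm (M *m x) | x in [set x | euclidean_norm x <= 1]].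

Definition controllable n m (A : 'M[K]_n) (B : 'M[K]_(n, m)) : Prop :=
  \rank (\mxrow_(k < n) (A ^+ k *m B)) = n.

Definition observable n m (A : 'M[K]_n) (C : 'M[K]_(m, n)) : Prop :=
  \rank (\mxcol_(k < n) (C *m A ^+ k)) = n.

Definition expmx n (A : 'M[K]_n) : 'M[K]_n :=
  limn (series (fun k => (k`!%:R)^-1 *: A ^+ k)).

Definition integralmx n (a b : K) (f : K -> 'M[K]_n) : 'M[K]_n :=
  \matrix_(i, j) \int[lebesgue_measure]_(s in `[a, b]) (f s i j).

Definition riccati n (A R S Q : 'M[K]_n) : 'M[K]_n :=
  A *m Q + Q *m A^T - Q *m S *m Q + R.

Definition obs_gramian n (A S : 'M[K]_n) (t : K) : 'M[K]_n :=
  integralmx 0 t (fun s => expmx (- s *: A^T) *m S *m expmx (- s *: A)).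

Definition ctr_gramian n (A R : 'M[K]_n) (t : K) : 'M[K]_n :=
  integralmx 0 t (fun s => expmx (s *: A) *m R *m expmx (s *: A^T)).

(* C_t(O) *)
Definition ctr_obs_gramian n (A R S : 'M[K]_n) (t : K) : 'M[K]_n :=
  let O := obs_gramian A S in
  invmx (O t) *m
  integralmx 0 t (fun s => expmx (- (t - s) *: A^T) *m O s *m R *m O s *m
                           expmx (- (t - s) *: A)) *m
  invmx (O t).

(* O_t(C) *)
Definition obs_ctr_gramian n (A R S : 'M[K]_n) (t : K) : 'M[K]_n :=
  let C := ctr_gramian A R in
  invmx (C t) *m
  integralmx 0 t (fun s => expmx ((t - s) *: A) *m C s *m S *m C s *m
                           expmx ((t - s) *: A^T)) *m
  invmx (C t).

Definition between_pos_scalars n (M : 'M[K]_n) : Prop :=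
  exists a b : K, [/\ 0 < a, 0 < b, loewner a%:M M & loewner M b%:M].

Definition obs_ctr_interval n (A R S : 'M[K]_n) (u : K) : Prop :=
  [/\ 0 < u,
      between_pos_scalars (obs_gramian A S u),
      between_pos_scalars (ctr_gramian A R u),
      between_pos_scalars (ctr_obs_gramian A R S u) &
      between_pos_scalars (obs_ctr_gramian A R S u)].

(* [P] solves P' = F(P) on [0, +oo[ with P(0) = Q; the derivative at 0 is the
   right derivative, and the values of [P] at negative times are irrelevant. *)
Definition solves n (F : 'M[K]_n -> 'M[K]_n) (Q : 'M[K]_n)
    (P : K -> 'M[K]_n) : Prop :=
  [/\ P 0 = Q,
      h^-1 *: (P h - P 0) @[h --> 0^'+] --> F (P 0) &
      forall t : K, 0 < t -> is_derive t 1 P (F (P t))].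

Definition flow n (F : 'M[K]_n -> 'M[K]_n) (phi : K -> 'M[K]_n -> 'M[K]_n) :
    Prop :=
  forall Q, psd Q -> solves F Q (fun t => phi t Q).

Definition solves_in_psd n (F : 'M[K]_n -> 'M[K]_n) (Q : 'M[K]_n)
    (P : K -> 'M[K]_n) : Prop :=
  solves F Q P /\ forall t : K, 0 <= t -> psd (P t).

(* For a vector field that is meaningful on positive semi-definite matrices
   only and whose initial value problems are well posed there. *)
Definition unique_psd_flow n (F : 'M[K]_n -> 'M[K]_n)
    (phi : K -> 'M[K]_n -> 'M[K]_n) : Prop :=
  forall Q, psd Q ->
    solves_in_psd F Q (fun t => phi t Q) /\
    forall P, solves_in_psd F Q P -> forall t : K, 0 <= t -> P t = phi t Q.

Definition perturbed_riccati n (pi : 'M[K]_n -> 'M[K]_n) (A R S Q : 'M[K]_n) :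
    'M[K]_n :=
  (A - pi Q *m S) *m Q + Q *m (A - pi Q *m S)^T + R + pi Q *m S *m pi Q.

End Definitions.

(* Main.v *)
Require Import Defs.
From HB Require Import structures.
From mathcomp Require Import all_boot all_order all_algebra.
From mathcomp Require Import all_classical all_reals all_analysis.
From mathcomp Require Import ring lra.

(* Everything reduces to one positivity principle: if D is symmetric, D(0) >= 0
   and D' = A(t) D + D A(t)^T + G(t) with G >= 0, then D stays >= 0.

   - Comparison.  For two trajectories X, Y of Riccati type, D = X - Y solves
     such an equation with A(t) = A - (X + Y) S / 2, since
     X S X - Y S Y = ((X + Y) S (X - Y) + (X - Y) S (X + Y)) / 2; the extra
     term G is Gamma_pi for phi <= phi^pi, and varpi Id - Rem for
     phi^pi <= phi_pi.
   - Upper bound.  With O the observability Gramian, O P O - O satisfies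
     X' = - A^T X - X A + O R O - (O P - 1) S (P O - 1); dropping the last
     term and integrating gives O P O - O <= O C(O) O.
   - Lower bound.  With C the controllability Gramian and
     M' = A M + M A^T + R + C S C, the block matrix [[P, C], [C, M]] solves a
     Lyapunov equation with closed loop diag(A - P S, A) and source
     [1; 1] R [1, 1] + [P; C] S [P, C], so it remains >= 0; the bound is its
     Schur complement.  Unlike the argument by duality, this never inverts P.

   Both bounds are applied on the window [t - upsilon, t]. *)

Set Implicit Arguments.
Unset Strict Implicit.
Unset Printing Implicit Defensive.

Import Order.TTheory GRing.Theory Num.Theory.
Import numFieldNormedType.Exports.

Local Open Scope classical_set_scope.
Local Open Scope ring_scope.

(** * Entrywise differential calculus for matrix functions on the half-line *)

Section MatrixDerivative.
Context {K : realType}.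

(* On [0, +oo[, with [f] unconstrained at [0]: there only right continuity of
   [F] is required. *)
Definition has_mxderiv m n (F f : K -> 'M[K]_(m, n)) : Prop :=
  forall i j, F x i j @[x --> 0^'+] --> F 0 i j /\
    forall t : K, 0 < t -> is_derive t 1 (fun x => F x i j) (f t i j).

Lemma has_mxderiv_eq m n (F f g : K -> 'M[K]_(m, n)) :
  has_mxderiv F f -> (forall t, 0 < t -> f t = g t) -> has_mxderiv F g.
Proof.
move=> Ff fg i j; have [F0 Fd] := Ff i j; split=> // t t0.
by rewrite -fg//; exact: Fd.
Qed.

Lemma has_mxderiv_cst m n (M : 'M[K]_(m, n)) : has_mxderiv (fun=> M) (fun=> 0).
Proof.
by move=> i j; split=> [|t _]; [exact: cvg_cst|rewrite mxE; exact: is_derive_cst].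
Qed.

Lemma has_mxderivD m n (F G f g : K -> 'M[K]_(m, n)) :
  has_mxderiv F f -> has_mxderiv G g ->
  has_mxderiv (fun t => F t + G t) (fun t => f t + g t).
Proof.
move=> Ff Gg i j; have [F0 Fd] := Ff i j; have [G0 Gd] := Gg i j.
have -> : (fun x => (F x + G x) i j) = (fun x => F x i j) \+ (fun x => G x i j).
  by apply/funext => x; rewrite mxE.
split=> [|t t0]; first by rewrite mxE; exact: cvgD.
rewrite mxE; have := Fd t t0; have := Gd t t0 => ? ?; exact: is_deriveD.
Qed.

Lemma has_mxderiv_tr m n (F f : K -> 'M[K]_(m, n)) :
  has_mxderiv F f -> has_mxderiv (fun t => (F t)^T) (fun t => (f t)^T).
Proof.
move=> Ff i j; have [F0 Fd] := Ff j i.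
have -> : (fun x => (F x)^T i j) = (fun x => F x j i).
  by apply/funext => x; rewrite mxE.
by split=> [|t t0]; rewrite mxE//; exact: Fd.
Qed.

Lemma has_mxderivM m n p (F f : K -> 'M[K]_(m, n)) (G g : K -> 'M[K]_(n, p)) :
  has_mxderiv F f -> has_mxderiv G g ->
  has_mxderiv (fun t => F t *m G t) (fun t => f t *m G t + F t *m g t).
Proof.
move=> Ff Gg i j.
have -> : (fun x => (F x *m G x) i j) =
    \sum_(k < n) ((fun x => F x i k) * (fun x => G x k j)).
  by apply/funext => x; rewrite mxE fct_sumE; apply: eq_bigr.
split=> [|t t0].
  have -> : (F 0 *m G 0) i j = \sum_(k < n) F 0 i k * G 0 k j by rewrite mxE.
  rewrite (_ : \sum_(k < n) _ = fun x => \sum_(k < n) (F x i k * G x k j)).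
    apply: cvg_big => [|k _]; first exact: add_continuous.
    by apply: cvgM; [exact: (Ff i k).1|exact: (Gg k j).1].
  by apply/funext => x; rewrite fct_sumE.
have -> : (f t *m G t + F t *m g t) i j =
    \sum_(k < n) (F t i k *: g t k j + G t k j *: f t i k).
  rewrite !mxE -big_split/=; apply: eq_bigr => k _.
  by rewrite addrC /GRing.scale/= [G t k j * _]mulrC.
apply: is_derive_sum => k.
have := (Ff i k).2 t t0; have := (Gg k j).2 t t0 => h1 h2.
exact: is_deriveM.
Qed.

Lemma has_mxderivMl m n p (A : 'M[K]_(m, n)) (F f : K -> 'M[K]_(n, p)) :
  has_mxderiv F f -> has_mxderiv (fun t => A *m F t) (fun t => A *m f t).
Proof.
move=> Ff; apply: has_mxderiv_eq (has_mxderivM (has_mxderiv_cst A) Ff) _.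
by move=> t _; rewrite mul0mx add0r.
Qed.

Lemma has_mxderivMr m n p (F f : K -> 'M[K]_(m, n)) (A : 'M[K]_(n, p)) :
  has_mxderiv F f -> has_mxderiv (fun t => F t *m A) (fun t => f t *m A).
Proof.
move=> Ff; apply: has_mxderiv_eq (has_mxderivM Ff (has_mxderiv_cst A)) _.
by move=> t _; rewrite mulmx0 addr0.
Qed.

Lemma has_mxderivZ m n (c : K) (F f : K -> 'M[K]_(m, n)) :
  has_mxderiv F f -> has_mxderiv (fun t => c *: F t) (fun t => c *: f t).
Proof.
move=> Ff; have := has_mxderivMl c%:M Ff.
have E (X : K -> 'M[K]_(m, n)) : (fun t => c%:M *m X t) = (fun t => c *: X t).
  by apply/funext => t; rewrite mul_scalar_mx.
by rewrite !E.
Qed.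

Lemma has_mxderivB m n (F G f g : K -> 'M[K]_(m, n)) :
  has_mxderiv F f -> has_mxderiv G g ->
  has_mxderiv (fun t => F t - G t) (fun t => f t - g t).
Proof.
move=> Ff /(has_mxderivZ (-1)) /(has_mxderivD Ff).
have E (X Y : K -> 'M[K]_(m, n)) :
    (fun t => X t + -1 *: Y t) = (fun t => X t - Y t).
  by apply/funext => t; rewrite scaleN1r.
by rewrite !E.
Qed.

Lemma has_mxderiv_block m1 m2 n1 n2
    (F f : K -> 'M[K]_(m1, n1)) (G g : K -> 'M[K]_(m1, n2))
    (H h : K -> 'M[K]_(m2, n1)) (L l : K -> 'M[K]_(m2, n2)) :
  has_mxderiv F f -> has_mxderiv G g -> has_mxderiv H h -> has_mxderiv L l ->
  has_mxderiv (fun t => block_mx (F t) (G t) (H t) (L t))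
              (fun t => block_mx (f t) (g t) (h t) (l t)).
Proof.
move=> Ff Gg Hh Ll i j.
case: (split_ordP i) => i' ->; case: (split_ordP j) => j' ->.
- have E (X : K -> 'M[K]_(m1, n1)) Y Z (T : K -> 'M[K]_(m2, n2)) :
    (fun t => block_mx (X t) (Y t) (Z t) (T t) (lshift m2 i') (lshift n2 j')) =
    (fun t => X t i' j') by apply/funext => t; rewrite block_mxEul.
  rewrite !E block_mxEul; have [? F'] := Ff i' j'; split=> // t t0.
  by rewrite block_mxEul; exact: F'.
- have E (X : K -> 'M[K]_(m1, n1)) Y Z (T : K -> 'M[K]_(m2, n2)) :
    (fun t => block_mx (X t) (Y t) (Z t) (T t) (lshift m2 i') (rshift n1 j')) =
    (fun t => Y t i' j') by apply/funext => t; rewrite block_mxEur.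
  rewrite !E block_mxEur; have [? F'] := Gg i' j'; split=> // t t0.
  by rewrite block_mxEur; exact: F'.
- have E (X : K -> 'M[K]_(m1, n1)) Y Z (T : K -> 'M[K]_(m2, n2)) :
    (fun t => block_mx (X t) (Y t) (Z t) (T t) (rshift m1 i') (lshift n2 j')) =
    (fun t => Z t i' j') by apply/funext => t; rewrite block_mxEdl.
  rewrite !E block_mxEdl; have [? F'] := Hh i' j'; split=> // t t0.
  by rewrite block_mxEdl; exact: F'.
- have E (X : K -> 'M[K]_(m1, n1)) Y Z (T : K -> 'M[K]_(m2, n2)) :
    (fun t => block_mx (X t) (Y t) (Z t) (T t) (rshift m1 i') (rshift n1 j')) =
    (fun t => T t i' j') by apply/funext => t; rewrite block_mxEdr.
  rewrite !E block_mxEdr; have [? F'] := Ll i' j'; split=> // t t0.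
  by rewrite block_mxEdr; exact: F'.
Qed.

Lemma has_mxderiv_continuous m n (F f : K -> 'M[K]_(m, n)) :
  has_mxderiv F f ->
  forall i j, {within `[0, +oo[, continuous (fun x => F x i j)}.
Proof.
move=> Ff i j; have [F0 Fd] := Ff i j.
apply/continuous_within_itvcyP; split=> // x; rewrite in_itv/= andbT => x0.
apply: differentiable_continuous; apply/derivable1_diffP.
by have [] := Fd x x0.
Qed.

(** Each entry is continuous on a compact interval, hence bounded there; the sum of these bounds
    serves all entries at once. *)
Lemma has_mxderiv_bounded m n (F f : K -> 'M[K]_(m, n)) (T : K) :
  0 <= T -> has_mxderiv F f ->
  exists2 c, 0 <= c & forall t i j, 0 <= t -> t <= T -> `|F t i j| <= c.
Proof.
move=> T0 Ff.
have H (ij : 'I_m * 'I_n) :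
    exists c, forall t, 0 <= t -> t <= T -> `|F t ij.1 ij.2| <= c.
  have cF : {within `[0, T], continuous (fun x => `|F x ij.1 ij.2|)}.
    have sub : `[0, T] `<=` `[0, +oo[ by apply: subset_itvl.
    have h0 : {within `[0, +oo[, continuous (fun x => F x ij.1 ij.2)}.
      exact: has_mxderiv_continuous Ff _ _.
    have h := continuous_subspaceW sub h0.
    by move=> x; apply: continuous_comp; [exact: h|exact: norm_continuous].
  have [c _ Hc] := EVT_max T0 cF; exists `|F c ij.1 ij.2| => t t0 tT.
  by apply: Hc; rewrite in_itv/= t0.
have [c Hc] := choice H.
exists (\sum_ij `|c ij|); first by apply: sumr_ge0.
move=> t i j t0 tT; apply: le_trans (Hc (i, j) t t0 tT) _.
by rewrite (bigD1 (i, j))//= (le_trans (ler_norm _))// lerDl sumr_ge0.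
Qed.

End MatrixDerivative.

(** * Quadratic forms, definiteness and quantitative bounds *)

Section QuadraticForms.
Context {K : realType}.

Definition qform n (M : 'M[K]_n) (x : 'cV[K]_n) : K := (x^T *m M *m x) 0 0.

Lemma qform_bilin n (M : 'M[K]_n) (x y : 'cV[K]_n) (s : K) : M^T = M ->
  qform M (x + s *: y) =
  qform M x + 2 * s * (y^T *m M *m x) 0 0 + s ^+ 2 * qform M y.
Proof.
move=> MT; rewrite /qform.
have E : (x^T *m M *m y) 0 0 = (y^T *m M *m x) 0 0.
  have -> : x^T *m M *m y = (y^T *m M *m x)^T.
    by rewrite !trmx_mul trmxK MT mulmxA.
  by rewrite mxE.
have D (a b : 'M[K]_1) : (a + b) 0 0 = a 0 0 + b 0 0 by rewrite mxE.
have Z c (a : 'M[K]_1) : (c *: a) 0 0 = c * a 0 0 by rewrite mxE.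
rewrite [(x + _)^T]linearD/= [(s *: y)^T]linearZ/= !mulmxDl !mulmxDr.
rewrite -!scalemxAl -!scalemxAr.
rewrite !(D, Z) E; ring.
Qed.

Lemma qformD n (M N : 'M[K]_n) x : qform (M + N) x = qform M x + qform N x.
Proof. by rewrite /qform mulmxDr mulmxDl mxE. Qed.

Lemma qformB n (M N : 'M[K]_n) x : qform (M - N) x = qform M x - qform N x.
Proof. by rewrite /qform mulmxBr mulmxBl !mxE. Qed.

Lemma qformZ n c (M : 'M[K]_n) x : qform (c *: M) x = c * qform M x.
Proof. by rewrite /qform -scalemxAr -scalemxAl mxE. Qed.

Lemma qform_tr n (M : 'M[K]_n) x : qform M^T x = qform M x.
Proof.
rewrite /qform; have -> : x^T *m M^T *m x = (x^T *m M *m x)^T.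
  by rewrite !trmx_mul trmxK mulmxA.
by rewrite mxE.
Qed.

Lemma qformE n (M : 'M[K]_n) x :
  qform M x = \sum_i \sum_j x i 0 * M i j * x j 0.
Proof.
rewrite /qform mxE exchange_big/=; apply: eq_bigr => j _.
by rewrite mxE big_distrl/=; apply: eq_bigr => i _; rewrite mxE.
Qed.

Lemma qform1E n (x : 'cV[K]_n) : qform 1%:M x = \sum_i x i 0 ^+ 2.
Proof.
rewrite /qform mulmx1 mxE; apply: eq_bigr => i _.
by rewrite mxE expr2.
Qed.

Lemma qform1_ge0 n (x : 'cV[K]_n) : 0 <= qform 1%:M x.
Proof. by rewrite qform1E; apply: sumr_ge0 => i _; exact: sqr_ge0. Qed.

Lemma qform1_gt0 n (x : 'cV[K]_n) : x != 0 -> 0 < qform 1%:M x.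
Proof.
move=> x0; rewrite lt_neqAle qform1_ge0 andbT eq_sym.
apply: contra x0; rewrite qform1E psumr_eq0 => [/allP h|i _]; last exact: sqr_ge0.
apply/eqP/colP => i; have := h i (mem_index_enum i).
by rewrite sqrf_eq0 => /eqP ->; rewrite mxE.
Qed.

Lemma qform_scalar n (c : K) (x : 'cV[K]_n) :
  qform c%:M x = c * qform 1%:M x.
Proof. by rewrite -qformZ scalemx1. Qed.

Lemma qform_conj m n (M : 'M[K]_m) (E : 'M[K]_(m, n)) x :
  qform (E^T *m M *m E) x = qform M (E *m x).
Proof. by rewrite /qform trmx_mul !mulmxA. Qed.

Lemma psd_conj m n (M : 'M[K]_m) (E : 'M[K]_(m, n)) :
  psd M -> psd (E^T *m M *m E).
Proof.
move=> [MT M0]; split; first by rewrite !trmx_mul trmxK MT mulmxA.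
by move=> x; rewrite -/(qform _ x) qform_conj; exact: M0.
Qed.

Lemma psdD n (M N : 'M[K]_n) : psd M -> psd N -> psd (M + N).
Proof.
move=> [MT M0] [NT N0]; split; first by rewrite linearD/= MT NT.
by move=> x; rewrite -/(qform _ x) qformD addr_ge0//; [exact: M0|exact: N0].
Qed.

Lemma posdef_psd n (M : 'M[K]_n) : posdef M -> psd M.
Proof.
move=> [MT M0]; split=> // x; have [->|x0] := eqVneq x 0.
  by rewrite mulmx0 mxE.
exact/ltW/M0.
Qed.

(** If [y = M *m x] were nonzero, a small move from [x] along [- y] would make the form negative: it
    is [0] at [x] and its first-order change is proportional to minus the squared length of [y]. *)
Lemma psd_qform0 n (M : 'M[K]_n) x : psd M -> qform M x = 0 -> M *m x = 0.
Proof.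
move=> [MT M0] Mx0; apply/eqP/contraT => /qform1_gt0.
set y := M *m x; set a := qform _ y => a0; set q := qform M y.
have q0 : 0 <= q by exact: M0.
have ay : (y^T *m M *m x) 0 0 = a by rewrite /a /qform mulmx1 -mulmxA.
have q1 : 0 < q + 1 by rewrite ltr_wpDl.
(* The exact minimiser is [- a / q]; using [q + 1] instead avoids dividing by a possibly zero [q]
   and still gives a negative value. *)
have : 0 <= qform M (x + (- a / (q + 1)) *: y) by exact: M0.
rewrite qform_bilin// Mx0 ay -/q add0r.
have -> : 2 * (- a / (q + 1)) * a + (- a / (q + 1)) ^+ 2 * q =
          - (a ^+ 2 * (q + 2) / (q + 1) ^+ 2).
  by field; rewrite gt_eqF.
rewrite oppr_ge0 leNgt divr_gt0 ?exprn_gt0// mulr_gt0 ?exprn_gt0//.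
by rewrite ltr_wpDl.
Qed.

Lemma posdef_unitmx n (M : 'M[K]_n) : posdef M -> M \in unitmx.
Proof.
move=> [MT M0]; rewrite -row_free_unit -kermx_eq0.
apply/eqP/row_matrixP => i; rewrite row0.
set v := row i _; apply/eqP/contraT => v0.
have vM : v *m M = 0 by apply/sub_kermxP; exact: row_sub.
have := M0 v^T; rewrite trmxK vM mul0mx mxE ltxx; apply.
by apply: contra v0 => /eqP h; rewrite -[v]trmxK h trmx0.
Qed.

Lemma psd_unitmx_posdef n (M : 'M[K]_n) :
  psd M -> M \in unitmx -> posdef M.
Proof.
move=> Mp Mu; split=> [|x x0]; first by case: Mp.
rewrite lt_neqAle Mp.2 andbT eq_sym; apply: contra x0 => /eqP.
by move=> /(psd_qform0 Mp) Mx; rewrite -[x](mulKmx Mu) Mx mulmx0.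
Qed.

(** A degenerate semi-definite matrix is singular, and symmetry turns a left kernel vector into a
    right one. The positivity principle reaches its contradiction at such a vector. *)
Lemma psd_not_posdef n (M : 'M[K]_n) : psd M -> ~ posdef M ->
  exists2 x : 'cV[K]_n, x != 0 & M *m x = 0.
Proof.
move=> Mp Mnp.
have : ~ M \in unitmx by move/(psd_unitmx_posdef Mp).
rewrite -row_free_unit -kermx_eq0 => /negP /rowV0Pn[v vker v0].
exists v^T; first by apply: contra v0 => /eqP h; rewrite -[v]trmxK h trmx0.
have /sub_kermxP vM := vker.
by rewrite -[M]Mp.1 -trmx_mul vM trmx0.
Qed.

Lemma posdef_invmx n (M : 'M[K]_n) : posdef M -> posdef (invmx M).
Proof.
move=> Mp; have Mu := posdef_unitmx Mp.
have MiT : (invmx M)^T = invmx M by rewrite trmx_inv Mp.1.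
split=> // x x0.
have -> : invmx M = (invmx M)^T *m M *m invmx M by rewrite MiT mulVmx// mul1mx.
rewrite -/(qform _ x) qform_conj; apply: Mp.2.
by apply: contra x0 => /eqP h; rewrite -[x](mulKVmx Mu) h mulmx0.
Qed.

Lemma posdefD n (M N : 'M[K]_n) : posdef M -> psd N -> posdef (M + N).
Proof.
move=> [MT M0] [NT N0]; split; first by rewrite linearD/= MT NT.
move=> x x0; rewrite -/(qform _ x) qformD ltr_wpDr//; first exact: N0.
exact: M0.
Qed.

Lemma posdef_scalar n (c : K) : 0 < c -> posdef (c%:M : 'M[K]_n).
Proof.
move=> c0; split=> [|x x0]; first by rewrite tr_scalar_mx.
by rewrite -/(qform _ x) qform_scalar mulr_gt0// qform1_gt0.
Qed.

Lemma loewner_posdef n (c : K) (M : 'M[K]_n) :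
  0 < c -> loewner c%:M M -> posdef M.
Proof.
by move=> c0 h; rewrite -(subrKC c%:M M); apply: posdefD h; exact: posdef_scalar.
Qed.

Lemma psd_cauchy_schwarz n (M : 'M[K]_n) x y : psd M ->
  ((y^T *m M *m x) 0 0) ^+ 2 <= qform M x * qform M y.
Proof.
move=> Mp; have [MT M0] := Mp; set b := (_ *m x) 0 0.
have [h|h] := eqVneq (qform M y) 0.
  have yM : y^T *m M = 0.
    by rewrite -[y^T *m M]trmxK trmx_mul trmxK MT (psd_qform0 Mp h) trmx0.
  by rewrite /b yM mul0mx mxE expr0n/= h mulr0.
have y0 : 0 < qform M y by rewrite lt_neqAle eq_sym h; exact: M0.
(* This point minimises the form on the line through [x] directed by [y]; the minimum is the
   Cauchy-Schwarz defect divided by [qform M y]. *)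
have : 0 <= qform M (x + (- b / qform M y) *: y) by exact: M0.
rewrite qform_bilin// -/b.
have -> : qform M x + 2 * (- b / qform M y) * b +
    (- b / qform M y) ^+ 2 * qform M y =
    (qform M x * qform M y - b ^+ 2) / qform M y by field.
by rewrite pmulr_lge0 ?invr_gt0// subr_ge0.
Qed.

(* The constant is the trace of the inverse: Cauchy-Schwarz for the form [M]
   gives [x_i^2 <= (M^-1)_ii * qform M x]. *)
Lemma posdef_coercive n (M : 'M[K]_n) : posdef M ->
  exists2 c, 0 <= c & forall x, qform 1%:M x <= c * qform M x.
Proof.
move=> Mp; have Mu := posdef_unitmx Mp; have Mip := posdef_invmx Mp.
exists (\tr (invmx M)).
  apply: sumr_ge0 => i _; have := (posdef_psd Mip).2 (delta_mx i 0).
  by rewrite trmx_delta -rowE -colE !mxE.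
move=> x; rewrite qform1E mulr_suml; apply: ler_sum => i _.
have := psd_cauchy_schwarz x (invmx M *m delta_mx i 0) (posdef_psd Mp).
have -> : (invmx M *m delta_mx i 0)^T *m M *m x = row i x.
  by rewrite trmx_mul Mip.1 mulmxKV// trmx_delta -rowE.
rewrite [row i x 0 0]mxE mulrC; congr (_ <= _ * _).
rewrite /qform trmx_mul Mip.1 mulmxKV// trmx_delta -rowE mxE -colE.
by rewrite mxE.
Qed.

(** Bound [|x_i x_j|] by [(x_i^2 + x_j^2) / 2]; summing over both indices produces the factor
    [n]. *)
Lemma qform_bound n (M : 'M[K]_n) (c : K) x :
  0 <= c -> (forall i j, `|M i j| <= c) ->
  `|qform M x| <= c * n%:R * qform 1%:M x.
Proof.
move=> c0 Mc; rewrite qformE.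
have H i j : `|x i 0 * M i j * x j 0| <= c / 2 * (x i 0 ^+ 2 + x j 0 ^+ 2).
  rewrite !normrM mulrAC.
  apply: (@le_trans _ _ (`|x i 0| * `|x j 0| * c)).
    by apply: ler_wpM2l; [exact: mulr_ge0|exact: Mc].
  rewrite -(real_normK (num_real (x i 0))) -(real_normK (num_real (x j 0))).
  have := sqr_ge0 (`|x i 0| - `|x j 0|); nra.
apply: (le_trans (ler_norm_sum _ _ _)).
apply: (@le_trans _ _ (\sum_i \sum_j (c / 2 * (x i 0 ^+ 2 + x j 0 ^+ 2)))).
  apply: ler_sum => i _; apply: (le_trans (ler_norm_sum _ _ _)).
  by apply: ler_sum => j _; exact: H.
have -> : \sum_i \sum_j (c / 2 * (x i 0 ^+ 2 + x j 0 ^+ 2)) =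
    c / 2 * (\sum_(i < n) \sum_(j < n) x i 0 ^+ 2 +
             \sum_(i < n) \sum_(j < n) x j 0 ^+ 2).
  rewrite -big_split/= mulr_sumr; apply: eq_bigr => i _.
  by rewrite -big_split/= mulr_sumr.
rewrite -qform1E sumr_const card_ord.
have -> : \sum_(i < n) \sum_(j < n) x i 0 ^+ 2 = n%:R * qform 1%:M x.
  rewrite qform1E mulr_sumr; apply: eq_bigr => i _.
  by rewrite sumr_const card_ord mulr_natl.
by rewrite -mulr_natl le_eqVlt; apply/orP; left; apply/eqP; field.
Qed.

End QuadraticForms.

(** * Positivity and uniqueness for Lyapunov differential equations *)

Section Lyapunov.
Context {K : realType}.

(** Consider the supremum of the times up to which [P] holds throughout: closedness gives [P] there,
    and openness to the right would push past it if it were below [T]. *)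
Lemma real_induction (P : K -> Prop) (T : K) : P 0 ->
  (forall t : K, 0 < t -> t <= T ->
     (forall s : K, 0 <= s -> s < t -> P s) -> P t) ->
  (forall t : K, 0 <= t -> t < T -> P t -> \forall s \near t^'+, P s) ->
  forall t : K, 0 <= t -> t <= T -> P t.
Proof.
move=> P0 Pclosed Popen t1 t10 t1T.
have T0 := le_trans t10 t1T.
pose E := [set t : K |
  [/\ 0 <= t, t <= T & forall s : K, 0 <= s -> s <= t -> P s]].
have E0 : E 0.
  by split=> // s s0 s0'; have -> : s = 0 by apply/eqP; rewrite eq_le s0 s0'.
have supE : has_sup E by split; [exists 0|exists T => t []].
have u0 : 0 <= sup E by exact: (sup_upper_bound supE).
have uT : sup E <= T by apply: ge_sup; [exists 0|move=> t []].
have Pu s : 0 <= s -> s < sup E -> P s.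
  move=> s0 su; have [t [_ _ Pt] st] := sup_gt (ex_intro _ _ E0) su.
  by apply: Pt => //; exact: ltW.
have PsupE : P (sup E).
  have [u00|u00] := eqVneq (sup E) 0; first by rewrite u00.
  by apply: Pclosed => //; rewrite lt_neqAle eq_sym u00.
have PE s : 0 <= s -> s <= sup E -> P s.
  by move=> s0; rewrite le_eqVlt => /predU1P[->//|]; exact: Pu.
apply: (PE _ t10); apply: (le_trans t1T); rewrite leNgt; apply/negP => uT'.
have := Popen _ u0 uT' PsupE.
rewrite near_withinE => /nbhs_ballP[e /= e0 He].
pose v := Num.min T (sup E + e / 2).
have uv : sup E < v by rewrite lt_min uT' ltrDl divr_gt0.
have Ev : E v.
  split; [exact: le_trans (ltW uv)|by rewrite ge_min lexx|].
  move=> s s0 sv; have [su|us] := leP s (sup E); first exact: PE.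
  apply: He => //; rewrite /ball/= ltr0_norm ?subr_lt0// opprB.
  rewrite ltrBlDl (le_lt_trans sv)// gt_min; apply/orP; right.
  by rewrite ltrD2l ltr_pdivrMr// mulr_natr mulr2n ltrDl.
by have := sup_upper_bound supE Ev; rewrite leNgt uv.
Qed.

Lemma is_derive_left_ge0 (f : K -> K) (t d : K) : 0 < t -> is_derive t 1 f d ->
  (forall s : K, 0 <= s -> s < t -> 0 < f s) -> 0 <= f t.
Proof.
move=> t0 fd f0.
have cf : f x @[x --> t^'-] --> f t.
  apply: cvg_at_left_filter; apply: differentiable_continuous.
  by apply/derivable1_diffP; case: fd.
apply: (cvgr_to_ge cf); near=> s; apply/ltW/f0.
  by near: s; exact: nbhs_left_ge.
by near: s; exact: nbhs_left_lt.
Unshelve. all: by end_near. Qed.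

(** To the left of [t], the difference quotients have a positive numerator and a negative
    denominator. *)
Lemma is_derive_left_le0 (f : K -> K) (t d : K) : 0 < t -> is_derive t 1 f d ->
  (forall s : K, 0 <= s -> s < t -> 0 < f s) -> f t = 0 -> d <= 0.
Proof.
move=> t0 [df <-] f0 ft.
have cf : h^-1 *: ((f \o shift t) (h *: 1) - f t) @[h --> 0^'-] --> 'D_1 f t.
  by move: df; rewrite /derivable => /cvgP; apply: cvg_trans; apply: cvg_app;
    apply: within_subset => x; rewrite /= => /lt_eqF ->.
apply: (cvgr_to_le cf); near=> h.
have h0 : h < 0 by near: h; exact: nbhs_left_lt.
have th : - t <= h by near: h; apply: nbhs_left_ge; rewrite oppr_lt0.
rewrite ft subr0 /GRing.scale/= mulr1 nmulr_rle0 ?invr_lt0//.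
by apply/ltW/f0; lra.
Unshelve. all: by end_near. Qed.

Lemma has_mxderiv_scalar n (g g' : K -> K) :
  g x @[x --> 0^'+] --> g 0 -> (forall t : K, 0 < t -> is_derive t 1 g (g' t)) ->
  has_mxderiv (fun t => (g t)%:M : 'M[K]_n) (fun t => (g' t)%:M).
Proof.
move=> g0 gd i j.
have -> : (fun x => (g x)%:M i j : K) = (fun x => if i == j then g x else 0).
  by apply/funext => x; rewrite mxE; case: eqP.
split=> [|t t0]; rewrite mxE; case: eqP => // _.
- exact: cvg_cst.
- exact: gd.
- exact: is_derive_cst.
Qed.

Lemma has_mxderiv_qform n (D D' : K -> 'M[K]_n) x :
  has_mxderiv D D' -> forall t : K, 0 < t ->
  is_derive t 1 (fun s => qform (D s) x) (qform (D' t) x).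
Proof.
move=> DD' t t0.
exact: (has_mxderivMr x (has_mxderivMl x^T DD') 0 0).2.
Qed.

Lemma has_mxderiv_cvg_right m n (F f : K -> 'M[K]_(m, n)) i j (t : K) :
  has_mxderiv F f -> 0 <= t -> F x i j @[x --> t^'+] --> F t i j.
Proof.
move=> Ff; rewrite le_eqVlt => /predU1P[<-|t0]; first exact: (Ff i j).1.
apply: cvg_at_right_filter; apply: differentiable_continuous.
by apply/derivable1_diffP; have [] := (Ff i j).2 t t0.
Qed.

(** Coercivity of [D t] leaves room: if all entries move by less than [d], the form changes by at
    most half its value. *)
Lemma posdef_near_right n (D D' : K -> 'M[K]_n) (t : K) :
  has_mxderiv D D' -> (forall s : K, 0 <= s -> (D s)^T = D s) -> 0 <= t ->
  posdef (D t) -> \forall s \near t^'+, posdef (D s).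
Proof.
move=> DD' DT t0 Dp; have [c c0 Hc] := posdef_coercive Dp.
(* Chosen so that [d * n%:R * c <= 2^-1]; the added ones keep the denominator positive when [c] or
   [n] is zero. *)
pose d := (2 * (c + 1) * n.+1%:R)^-1.
have d0 : 0 < d by rewrite invr_gt0 !mulr_gt0 ?ltr_wpDl.
have H i j : \forall s \near t^'+, `|D t i j - D s i j| < d.
  by have /cvgrPdist_lt := @has_mxderiv_cvg_right _ _ _ _ i j t DD' t0; exact.
have {}H : \forall s \near t^'+, forall ij, `|D t ij.1 ij.2 - D s ij.1 ij.2| < d.
  by apply: filter_forall => -[i j]; exact: H.
near=> s.
have s0 : 0 <= s by apply: (le_trans t0); near: s; exact: nbhs_right_ge.
split=> [|x x0]; first exact: DT.
rewrite -/(qform _ x).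
have := @qform_bound _ _ (D t - D s) d x (ltW d0); rewrite qformB => h.
have : `|qform (D t) x - qform (D s) x| <= d * n%:R * qform 1%:M x.
  have Hs ij : `|D t ij.1 ij.2 - D s ij.1 ij.2| < d by move: ij; near: s.
  by apply: h => i j; rewrite !mxE; exact/ltW/(Hs (i, j)).
rewrite ler_norml => /andP[_ h1].
have q0 : 0 < qform 1%:M x by exact: qform1_gt0.
have h2 := Hc x.
have h3 : d * n%:R * c <= 2^-1.
  rewrite /d -mulrA ler_pdivrMl; last by rewrite !mulr_gt0 ?ltr_wpDl.
  rewrite -(natr1 n); have n0 := ler0n K n; have := mulr_ge0 n0 c0; lra.
have p0 : 0 < qform (D t) x by exact: Dp.2.
have : d * n%:R * qform 1%:M x <= 2^-1 * qform (D t) x.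
  apply: (@le_trans _ _ (d * n%:R * (c * qform (D t) x))).
    by apply: ler_wpM2l; rewrite ?mulr_ge0// ltW.
  by rewrite mulrA; apply: ler_wpM2r => //; exact: ltW.
lra.
Unshelve. all: by end_near. Qed.

Lemma lyapunov_psd n (D A A' G : K -> 'M[K]_n) (T : K) :
  has_mxderiv A A' ->
  has_mxderiv D (fun t => A t *m D t + D t *m (A t)^T + G t) ->
  (forall t : K, 0 <= t -> (D t)^T = D t) ->
  (forall (t : K) x, 0 < t -> t <= T -> 0 <= qform (G t) x) ->
  0 <= T -> psd (D 0) -> psd (D T).
Proof.
move=> AA' DD' DT G0 T0 D0; have [c c0 Ac] := has_mxderiv_bounded T0 AA'.
split=> [|x]; first exact: DT.
rewrite -/(qform _ x); apply/ler_addgt0Pr => e1 e10.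
(* [D t + e expR (l t) Id] starts positive definite and cannot degenerate: at a
   first kernel vector [y], the derivative of its quadratic form in [y] would
   be both nonpositive and positive. *)
pose l := 2 * (c * n%:R) + 1.
have l0 : 0 < l by rewrite ltr_wpDl// !mulr_ge0.
(* Scaled so that the perturbation at time [T], evaluated at [x], is at most [e1]. *)
pose e := e1 / (expR (l * T) * (qform 1%:M x + 1)).
have q1 : 0 < qform 1%:M x + 1 by rewrite ltr_wpDl// qform1_ge0.
have e0 : 0 < e by rewrite divr_gt0// mulr_gt0// expR_gt0.
pose g t := e * expR (l * t).
have g0 t : 0 < g t by rewrite mulr_gt0// expR_gt0.
have gd (t : K) : is_derive t 1 g (l * g t).
  have h1 : is_derive t 1 ( *%R l) l.
    apply: (is_derive_eq (is_deriveZ l (is_derive_id t 1))).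
    by rewrite /GRing.scale/= mulr1.
  have h2 : is_derive t 1 (expR \o *%R l) (expR (l * t) * l).
    exact: is_derive1_comp.
  apply: (is_derive_eq (is_deriveZ e h2)).
  by rewrite /g /GRing.scale/=; ring.
have gM : has_mxderiv (fun t => (g t)%:M : 'M[K]_n) (fun t => (l * g t)%:M).
  apply: has_mxderiv_scalar => //.
  apply: cvg_at_right_filter; apply: differentiable_continuous.
  by apply/derivable1_diffP; have [] := gd 0.
have DgD := has_mxderivD DD' gM.
have DgT t : 0 <= t -> (D t + (g t)%:M)^T = D t + (g t)%:M.
  by move=> t0; rewrite linearD/= DT// tr_scalar_mx.
have : posdef (D T + (g T)%:M).
  apply: (@real_induction (fun t => posdef (D t + (g t)%:M)) T) => //; first last.
  - by move=> t t0 _; exact: (posdef_near_right DgD).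
  - move=> t t0 tT IH; apply: contrapT => np.
    have IHq s y : y != 0 -> 0 <= s -> s < t -> 0 < qform (D s + (g s)%:M) y.
      by move=> y0 s0 st; exact: (IH s s0 st).2.
    have ps : psd (D t + (g t)%:M).
      split=> [|y]; first by rewrite DgT// ltW.
      have [->|y0] := eqVneq y 0; first by rewrite mulmx0 mxE.
      apply: (is_derive_left_ge0 t0 (has_mxderiv_qform y DgD t0)) => s.
      exact: IHq.
    have [y y0 Dy0] := psd_not_posdef ps np.
    have := is_derive_left_le0 t0 (has_mxderiv_qform y DgD t0)
      (fun s => IHq s y y0).
    rewrite {1}/qform -mulmxA Dy0 mulmx0 mxE => /(_ erefl).
    (* On the kernel vector, [D t] acts as multiplication by [- g t], so the drift contributes
       [- 2 * g t * qform (A t) y] to the derivative. *)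
    have Dy : D t *m y = - (g t) *: y.
      by apply/eqP; rewrite scaleNr -addr_eq0 -mul_scalar_mx -mulmxDl Dy0.
    have yD : y^T *m D t = - (g t) *: y^T.
      by rewrite -[D t]DT ?ltW// -trmx_mul Dy linearZ.
    have Aq : qform (A t *m D t + D t *m (A t)^T) y = - (2 * g t * qform (A t) y).
      rewrite qformD -[X in _ + X]qform_tr trmx_mul trmxK DT ?ltW//.
      rewrite {1 2}/qform -!mulmxA Dy -!scalemxAr mxE.
      by rewrite mulmxA -/(qform _ y); ring.
    rewrite !qformD qform_scalar -qformD Aq.
    (* The drift costs at most [2 * (c * n%:R)] times [g t * qform 1%:M y], while the perturbation
       contributes [l] times it; the surplus [1] in [l] makes the derivative positive. *)
    have := qform_bound y c0 (fun i j => Ac t i j (ltW t0) tT).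
    rewrite ler_norml => /andP[_ h].
    have q0 := qform1_gt0 y0; have G0t := G0 t y t0 tT.
    have : 2 * g t * qform (A t) y <= 2 * g t * (c * n%:R * qform 1%:M y).
      by apply: ler_wpM2l => //; rewrite mulr_ge0// ltW.
    have : 0 < g t * qform 1%:M y by rewrite mulr_gt0.
    rewrite /l => h1 h2 h3; apply/negP: h3; rewrite -ltNge.
    by nra.
  - by rewrite addrC; apply: posdefD D0; exact: posdef_scalar.
move=> /posdef_psd[_ /(_ x)]; rewrite -/(qform _ x) qformD qform_scalar.
move=> /le_trans; apply; rewrite lerD2l /g /e.
have -> : e1 / (expR (l * T) * (qform 1%:M x + 1)) * expR (l * T) * qform 1%:M x =
    e1 * (qform 1%:M x / (qform 1%:M x + 1)).
  by field; rewrite !gt_eqF ?expR_gt0.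
by rewrite ler_piMr ?(ltW e10)// ler_pdivrMr// mul1r lerDl.
Qed.

Lemma qform_block m n (M1 : 'M[K]_m) (M2 : 'M[K]_(m, n)) (M3 : 'M[K]_(n, m))
    (M4 : 'M[K]_n) (x : 'cV[K]_m) (y : 'cV[K]_n) :
  qform (block_mx M1 M2 M3 M4) (col_mx x y) =
  qform M1 x + (x^T *m M2 *m y) 0 0 + (y^T *m M3 *m x) 0 0 + qform M4 y.
Proof.
rewrite /qform tr_col_mx mul_row_block mul_row_col !mulmxDl !mxE.
ring.
Qed.

(** This is uniqueness for linear matrix equations, applied below to differences: it yields the
    symmetry of Riccati solutions and the differential equation of the Gramian. *)
Lemma lyapunov_eq0 n (D A A' : K -> 'M[K]_n) (T : K) :
  has_mxderiv A A' ->
  has_mxderiv D (fun t => A t *m D t + D t *m (A t)^T) ->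
  0 <= T -> D 0 = 0 -> D T = 0.
Proof.
move=> AA' DD' T0 D0.
have Z := has_mxderiv_cst (0 : 'M[K]_n).
(* A positive semi-definite matrix with zero diagonal blocks vanishes, so [D],
   which is not assumed symmetric, is handled through this block matrix. *)
have : psd (block_mx 0 (D T) (D T)^T 0).
  pose BD t := block_mx 0 (D t) (D t)^T 0.
  apply: (@lyapunov_psd _ BD (fun t => block_mx (A t) 0 0 (A t)) _ (fun=> 0) T
    (has_mxderiv_block AA' Z Z AA')) => //.
  - apply: has_mxderiv_eq (has_mxderiv_block Z DD' (has_mxderiv_tr DD') Z) _.
    move=> t t0; rewrite /BD tr_block_mx !mulmx_block !trmx0.
    rewrite !(mulmx0, mul0mx, addr0, add0r) add_block_mx !addr0.
    by congr block_mx; rewrite linearD/= !trmx_mul trmxK addrC.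
  - by move=> t _; rewrite /BD tr_block_mx !trmx0 trmxK.
  - by move=> t x _ _; rewrite /qform mulmx0 mul0mx mxE.
  - rewrite /BD D0 trmx0; split=> [|x]; first by rewrite tr_block_mx !trmx0.
    by rewrite block_mx0 mulmx0 mul0mx mxE.
move=> [_ H]; apply/matrixP => i j; rewrite mxE.
have : D T *m delta_mx j 0 = 0 :> 'cV_n.
  set x := _ *m _; apply/eqP/contraT => /qform1_gt0.
  (* On the vector with blocks [- x] and [delta_mx j 0], where [x] is column [j] of [D T], the form
     equals minus twice the squared length of [x]. *)
  have := H (col_mx (- x) (delta_mx j 0)); rewrite -/(qform _ _) qform_block.
  rewrite /qform mulmx1 !(mulmx0, mul0mx) -mulmxA -/x.
  have -> : (delta_mx j 0)^T *m (D T)^T = x^T by rewrite -trmx_mul.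
  have N (M : 'M[K]_1) : (- M) 0 0 = - M 0 0 by rewrite mxE.
  have O : (0 : 'M[K]_1) 0 0 = 0 by rewrite mxE.
  by rewrite linearN/= mulNmx mulmxN !N !O; lra.
by move=> /colP /(_ i); rewrite -colE !mxE.
Qed.

End Lyapunov.

(** * The matrix exponential as a family of scalar power series *)

Section MatrixExponential.
Context {K : realType}.

Lemma cvg_mx_entries (T : Type) (F : set_system T) m n
    (u : T -> 'M[K]_(m, n)) (M : 'M[K]_(m, n)) : Filter F ->
  (forall i j, u x i j @[x --> F] --> M i j) -> u x @[x --> F] --> M.
Proof.
move=> FF uM; rewrite [M]matrix_sum_delta.
rewrite (_ : (fun x => u x) =
  fun x => \sum_i \sum_j u x i j *: delta_mx i j); last first.
  by apply/funext => x; exact: matrix_sum_delta.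
apply: cvg_big => [|i _]; first exact: add_continuous.
apply: cvg_big => [|j _]; first exact: add_continuous.
by apply: cvgZr_tmp; exact: uM.
Qed.

(** Power series coefficients, in [t], of an entry of [M *m expmx (t *: A)]. The left factor [M]
    makes the family stable under termwise differentiation, which replaces [M] by [M *m A]. *)
Definition exp_entry n (A M : 'M[K]_n) i j : K^nat :=
  fun k => (M *m A ^+ k) i j / k`!%:R.

(** The sum of all absolute entries dominates every row sum, so each product by [A] costs one
    factor; this compares the entries of the exponential with a scalar exponential series. *)
Lemma normr_expr_entry n (A : 'M[K]_n) k i j :
  `|(A ^+ k) i j| <= (\sum_i \sum_j `|A i j|) ^+ k.
Proof.
set b := \sum_i _; have b0 : 0 <= b by do 2 apply: sumr_ge0 => ? _.
elim: k i j => [|k IH] i j.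
  by rewrite !expr0 mxE; case: eqP; rewrite ?normr1 ?normr0.
rewrite !exprS -mulmxE mxE; apply: (le_trans (ler_norm_sum _ _ _)).
apply: (@le_trans _ _ (\sum_l `|A i l| * b ^+ k)).
  by apply: ler_sum => l _; rewrite normrM ler_wpM2l.
rewrite -mulr_suml; apply: ler_wpM2r; first exact: exprn_ge0.
by rewrite /b [leRHS](bigD1 i)//= lerDl; do 2 apply: sumr_ge0 => ? _.
Qed.

Lemma is_cvg_exp_entry1 n (A : 'M[K]_n) i j t :
  cvgn (pseries (exp_entry A 1%:M i j) t).
Proof.
apply: normed_cvg; set b := \sum_i \sum_j `|A i j|.
apply: series_le_cvg (is_cvg_series_exp_coeff (b * `|t|)) => [k|k|k] /=.
- exact: normr_ge0.
- apply: exp_coeff_ge0; apply: mulr_ge0 => //.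
  by do 2 apply: sumr_ge0 => ? _.
- rewrite /exp_entry mul1mx /exp_coeff/= exprMn !normrM normrX mulrAC.
  rewrite normfV normr_nat; apply: ler_wpM2r; first by rewrite invr_ge0.
  by apply: ler_wpM2r; rewrite ?exprn_ge0//; exact: normr_expr_entry.
Qed.

Lemma exprZmx n (A : 'M[K]_n) (t : K) k : (t *: A) ^+ k = t ^+ k *: A ^+ k.
Proof.
elim: k => [|k IH]; first by rewrite !expr0 scale1r.
by rewrite !exprS -!mulmxE IH -scalemxAl -scalemxAr scalerA.
Qed.

Lemma series_exp_entry n (A : 'M[K]_n) t N i j :
  series (fun k => (k`!%:R)^-1 *: (t *: A) ^+ k) N i j =
  pseries (exp_entry A 1%:M i j) t N.
Proof.
rewrite /pseries /series/= summxE; apply: eq_bigr => k _.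
by rewrite exprZmx /exp_entry mul1mx !mxE; ring.
Qed.

Lemma expmx_entry n (A : 'M[K]_n) t i j :
  pseries (exp_entry A 1%:M i j) t @ \oo --> expmx (t *: A) i j.
Proof.
pose M := \matrix_(i, j) limn (pseries (exp_entry A 1%:M i j) t).
have cM : series (fun k => (k`!%:R)^-1 *: (t *: A) ^+ k) @ \oo --> M.
  apply: cvg_mx_entries => k l; under eq_cvg do rewrite series_exp_entry.
  by rewrite mxE; exact: is_cvg_exp_entry1.
have -> : expmx (t *: A) = M by apply: cvg_lim => //; exact: norm_hausdorff.
by rewrite mxE; exact: is_cvg_exp_entry1.
Qed.

Lemma exp_entry_cvg n (A M : 'M[K]_n) i j t :
  pseries (exp_entry A M i j) t @ \oo --> (M *m expmx (t *: A)) i j.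
Proof.
have -> : pseries (exp_entry A M i j) t =
    fun N => \sum_l (M i l * pseries (exp_entry A 1%:M l j) t N).
  apply/funext => N; rewrite /pseries /series/=.
  under [RHS]eq_bigr do rewrite mulr_sumr.
  rewrite exchange_big/=; apply: eq_bigr => k _.
  rewrite /exp_entry mxE mulr_suml mulr_suml; apply: eq_bigr => l _.
  by rewrite mul1mx; ring.
rewrite mxE; apply: cvg_big => [|l _]; first exact: add_continuous.
by apply: cvgM; [exact: cvg_cst|exact: expmx_entry].
Qed.

Lemma pseries_diffs_exp_entry n (A M : 'M[K]_n) i j :
  pseries_diffs (exp_entry A M i j) = exp_entry A (M *m A) i j.
Proof.
apply/funext => k; rewrite /pseries_diffs /exp_entry exprS -mulmxE mulmxA.
rewrite factS natrM; field.
by rewrite nat1r !pnatr_eq0 -lt0n fact_gt0.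
Qed.

Lemma is_derive_expmx n (A : 'M[K]_n) i j (t : K) :
  is_derive t 1 (fun s => expmx (s *: A) i j) ((A *m expmx (t *: A)) i j).
Proof.
have E M s : limn (pseries (exp_entry A M i j) s) = (M *m expmx (s *: A)) i j.
  by apply: cvg_lim => //; exact: exp_entry_cvg.
have C M s : cvgn (pseries (exp_entry A M i j) s).
  by apply: cvgP; exact: exp_entry_cvg.
rewrite -E; have -> : (fun s => expmx (s *: A) i j) =
    fun s => limn (pseries (exp_entry A 1%:M i j) s).
  by apply/funext => s; rewrite E mul1mx.
have -> : exp_entry A A i j = pseries_diffs (exp_entry A 1%:M i j).
  by rewrite pseries_diffs_exp_entry mul1mx.
(* The series converge everywhere, so any radius exceeding the absolute value of [t] works. *)
apply: (@pseries_snd_diffs _ _ (`|t| + 1)) => //.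
- by rewrite pseries_diffs_exp_entry.
- by rewrite !pseries_diffs_exp_entry.
- by rewrite [ltRHS]ger0_norm ?addr_ge0// ltrDl.
Qed.

Lemma trmx_expr n (A : 'M[K]_n) k : (A ^+ k)^T = A^T ^+ k.
Proof.
elim: k => [|k IH]; first by rewrite !expr0 trmx1.
by rewrite exprS exprSr -!mulmxE trmx_mul IH.
Qed.

Lemma trmx_expmx n (A : 'M[K]_n) (t : K) :
  (expmx (t *: A))^T = expmx (t *: A^T).
Proof.
apply/matrixP => i j; rewrite mxE.
have E (B : 'M[K]_n) k l : expmx (t *: B) k l =
    limn (pseries (exp_entry B 1%:M k l) t).
  by apply/esym/cvg_lim => //; exact: expmx_entry.
rewrite !E (_ : exp_entry A 1%:M j i = exp_entry A^T 1%:M i j)//.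
by apply/funext => k; rewrite /exp_entry !mul1mx -trmx_expr [in RHS]mxE.
Qed.

Lemma expmx0 n : expmx (0 : 'M[K]_n) = 1%:M.
Proof.
rewrite /expmx; apply: cvg_lim; first exact: (@norm_hausdorff K 'M[K]_n).
apply: cvg_near_cst; exists 1%N => // -[//|N] _.
rewrite /series/= big_nat_recl// big1 ?addr0 ?expr0 ?fact0 ?invr1 ?scale1r//.
by move=> k _; rewrite expr0n/= scaler0.
Qed.

(** An affine argument covers the exponentials of [s *: A], [- (u - s) *: A] and [(u - s) *: A]
    needed for the Gramians. *)
Lemma has_mxderiv_expmx_left n (A : 'M[K]_n) (a b : K) :
  has_mxderiv (fun s => expmx ((a + b * s) *: A))
              (fun s => b *: (A *m expmx ((a + b * s) *: A))).
Proof.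
move=> i j.
have H (t : K) : is_derive t 1 (fun s => expmx ((a + b * s) *: A) i j)
    ((b *: (A *m expmx ((a + b * t) *: A))) i j).
  have h1 : is_derive t 1 (fun s : K => a + b * s) b.
    have h0 : is_derive t 1 ( *%R b) b.
      by apply: (is_derive_eq (is_deriveZ b (is_derive_id t 1)));
        rewrite /GRing.scale/= mulr1.
    by apply: (is_derive_eq (is_deriveD (is_derive_cst a t 1) h0)); rewrite add0r.
  have := @is_derive1_comp _ (fun s => expmx (s *: A) i j)
    (fun s : K => a + b * s) t _ _ (is_derive_expmx A i j (a + b * t)) h1.
  by rewrite [in X in _ -> X]mxE [_ * b]mulrC.
split=> [|t _]; last exact: H.
apply: cvg_at_right_filter; apply: differentiable_continuous.
by apply/derivable1_diffP; have [] := H 0.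
Qed.

(** Transposing the left version for [A^T] avoids proving that [A] commutes with its exponential. *)
Lemma has_mxderiv_expmx_right n (A : 'M[K]_n) (a b : K) :
  has_mxderiv (fun s => expmx ((a + b * s) *: A))
              (fun s => b *: (expmx ((a + b * s) *: A) *m A)).
Proof.
have := has_mxderiv_tr (has_mxderiv_expmx_left A^T a b).
have E : (fun s => (expmx ((a + b * s) *: A^T))^T) =
    (fun s => expmx ((a + b * s) *: A)).
  by apply/funext => s; rewrite trmx_expmx trmxK.
rewrite E => /has_mxderiv_eq; apply => t _.
by rewrite linearZ/= trmx_mul trmx_expmx trmxK.
Qed.

End MatrixExponential.

(* Expands, abstracts each noncommutative monomial as an atom, and leaves an
   identity that is linear in the entries of these atoms. *)
Ltac mxring :=
  rewrite ?(mulmxDl, mulmxDr, mulmxN, mulNmx, mulmx1, mul1mx, mulmx0, mul0mx,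
            mulmxA, =^~ scalemxAl, =^~ scalemxAr);
  repeat match goal with |- context [?X *m ?Y] =>
    let M := fresh "M" in set M := X *m Y; clearbody M end;
  let i := fresh "i" in let j := fresh "j" in
  by apply/matrixP => i j; rewrite ?mxE; field.

(** * Integrals of matrix functions and the equations of the Gramians *)

Section Gramians.
Context {K : realType}.

Lemma has_mxderiv_expmx n (A : 'M[K]_n) :
  has_mxderiv (fun s => expmx (s *: A)) (fun s => A *m expmx (s *: A)).
Proof.
have := has_mxderiv_expmx_left A 0 1.
rewrite (_ : (fun s => _) = (fun s => expmx (s *: A))); last first.
  by apply/funext => s; rewrite add0r mul1r.
by move/has_mxderiv_eq; apply => s _; rewrite add0r mul1r scale1r.
Qed.

Lemma integralmx_point n (a : K) (f : K -> 'M[K]_n) : integralmx a a f = 0.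
Proof.
by apply/matrixP => i j; rewrite !mxE set_itv1 Rintegral_set1.
Qed.

(** Fundamental theorem of calculus; differentiability of [f] supplies the continuity. *)
Lemma has_mxderiv_integralmx n (f f' : K -> 'M[K]_n) :
  has_mxderiv f f' -> has_mxderiv (fun t => integralmx 0 t f) f.
Proof.
move=> ff' i j.
have E : (fun t => integralmx 0 t f i j) =
    fun t => \int[lebesgue_measure]_(s in `[0, t]) f s i j.
  by apply/funext => t; rewrite mxE.
have intf u : lebesgue_measure.-integrable `[0, u] (EFin \o (fun s => f s i j)).
  apply: continuous_compact_integrable; first exact: segment_compact.
  have h0 : {within `[0, +oo[, continuous (fun x => f x i j)}.
    exact: has_mxderiv_continuous ff' _ _.
  by apply: continuous_subspaceW h0; exact: subset_itvl.
split=> [|t t0].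
  rewrite integralmx_point mxE E; apply: cvg_at_right_filter.
  exact: (parameterized_integral_cvg_left ltr01 (intf 1)).
have cf : {for t, continuous (fun s => f s i j)}.
  apply: differentiable_continuous; apply/derivable1_diffP.
  by have [] := (ff' i j).2 t t0.
have tt1 : t < t + 1 by rewrite ltrDl.
have [dF Fe] := continuous_FTC1_closed tt1 (intf _) t0 cf.
by rewrite E; apply: DeriveDef; [exact: dF|rewrite -derive1E; exact: Fe].
Qed.

Lemma integralmx_sym n (a b : K) (f : K -> 'M[K]_n) :
  (forall s, (f s)^T = f s) -> (integralmx a b f)^T = integralmx a b f.
Proof.
move=> fT; apply/matrixP => i j; rewrite !mxE.
by apply: eq_Rintegral => s _; rewrite -[in RHS]fT mxE.
Qed.

(** Duality: facts about one Gramian transfer to the other. *)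
Lemma obs_gramianE n (A S : 'M[K]_n) :
  obs_gramian A S = ctr_gramian (- A^T) S.
Proof.
apply/funext => t; rewrite /obs_gramian /ctr_gramian; congr integralmx.
apply/funext => s.
by rewrite [(- A^T)^T]linearN/= trmxK !scalerN !scaleNr.
Qed.

Lemma ctr_gramian0 n (A R : 'M[K]_n) : ctr_gramian A R 0 = 0.
Proof. exact: integralmx_point. Qed.

Lemma ctr_gramian_sym n (A R : 'M[K]_n) t :
  R^T = R -> (ctr_gramian A R t)^T = ctr_gramian A R t.
Proof.
move=> RT; apply: integralmx_sym => s.
by rewrite !trmx_mul !trmx_expmx trmxK RT mulmxA.
Qed.

(** The derivative is the integrand [E]. Its difference with the claimed expression has zero
    derivative, because [E] solves the homogeneous equation, and vanishes at [0], where [E] is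
    [R]. *)
Lemma has_mxderiv_ctr_gramian n (A R : 'M[K]_n) :
  has_mxderiv (ctr_gramian A R)
    (fun t => A *m ctr_gramian A R t + ctr_gramian A R t *m A^T + R).
Proof.
pose E t := expmx (t *: A) *m R *m expmx (t *: A^T).
have E' : has_mxderiv E (fun t => A *m E t + E t *m A^T).
  have E1 : (fun t : K => expmx (t *: A^T)) = (fun t => (expmx (t *: A))^T).
    by apply/funext => t; rewrite trmx_expmx.
  have h := has_mxderiv_tr (has_mxderiv_expmx A); rewrite -E1 in h.
  apply: has_mxderiv_eq
    (has_mxderivM (has_mxderivMr R (has_mxderiv_expmx A)) h) _.
  by move=> t _; rewrite trmx_mul trmx_expmx /E !mulmxA.
have C' := has_mxderiv_integralmx E'.
apply: (has_mxderiv_eq C') => t t0; apply/eqP; rewrite -subr_eq0; apply/eqP.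
pose C t := ctr_gramian A R t.
apply: (@lyapunov_eq0 _ _ (fun t => E t - (A *m C t + C t *m A^T + R)) (fun=> 0)
  _ t (has_mxderiv_cst 0)) => //.
- have h := has_mxderivB E' (has_mxderivD (has_mxderivD
    (has_mxderivMl A C') (has_mxderivMr A^T C')) (has_mxderiv_cst R)).
  apply: has_mxderiv_eq h _ => s _.
  by rewrite addr0 subrr mul0mx trmx0 mulmx0 addr0.
- exact: ltW.
- rewrite /E /C ctr_gramian0 !scale0r !expmx0 mul1mx mulmx1 mulmx0 mul0mx.
  by rewrite !add0r subrr.
Qed.

End Gramians.

(** * Comparison and two-sided bounds for Riccati equations *)

Section Riccati.
Context {K : realType} (n : nat).
Implicit Types (A R S : 'M[K]_n) (P X Y : K -> 'M[K]_n).

Lemma tr_riccati A R S (Q : 'M[K]_n) : R^T = R -> S^T = S ->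
  (riccati A R S Q)^T = riccati A R S Q^T.
Proof.
move=> RT ST; rewrite /riccati !linearD/= linearN/= !trmx_mul trmxK RT ST.
by rewrite [X in X - _]addrC !mulmxA.
Qed.

(** Splitting the quadratic term evenly makes the right factor the transpose of the left one for
    symmetric data, as a Lyapunov equation requires. *)
Lemma riccatiB A R S (X Y : 'M[K]_n) :
  riccati A R S X - riccati A R S Y =
  (A - 2^-1 *: ((X + Y) *m S)) *m (X - Y) +
  (X - Y) *m (A^T - 2^-1 *: (S *m (X + Y))).
Proof. rewrite /riccati; mxring. Qed.

Lemma tr_closed_loop A S (M : 'M[K]_n) : S^T = S -> M^T = M ->
  (A - 2^-1 *: (M *m S))^T = A^T - 2^-1 *: (S *m M).
Proof.
move=> ST MT; rewrite [(A - _)^T]linearB/= [(_ *: _)^T]linearZ/=.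
by rewrite trmx_mul ST MT.
Qed.

Lemma has_mxderiv_closed_loop A S X X' Y Y' :
  has_mxderiv X X' -> has_mxderiv Y Y' ->
  has_mxderiv (fun t => A - 2^-1 *: ((X t + Y t) *m S))
    (fun t => 0 - 2^-1 *: ((X' t + Y' t) *m S)).
Proof.
move=> XX' YY'; apply: has_mxderivB; first exact: has_mxderiv_cst.
by apply: has_mxderivZ; apply: has_mxderivMr; exact: has_mxderivD.
Qed.

(** [P] and its transpose solve the same equation, so their difference solves a homogeneous Lyapunov
    equation with zero initial value. *)
Lemma riccati_sym A R S P : R^T = R -> S^T = S ->
  has_mxderiv P (fun t => riccati A R S (P t)) -> (P 0)^T = P 0 ->
  forall t : K, 0 <= t -> (P t)^T = P t.
Proof.
move=> RT ST PP' P0 t t0; apply/esym/eqP; rewrite -subr_eq0; apply/eqP.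
have PTT' := has_mxderiv_tr PP'.
apply: (@lyapunov_eq0 _ _ (fun t => P t - (P t)^T) _ _ t
  (has_mxderiv_closed_loop A S PP' PTT')) => //; last by rewrite P0 subrr.
apply: has_mxderiv_eq (has_mxderivB PP' PTT') _ => s _.
rewrite tr_riccati// riccatiB; congr (_ + _ *m _).
by rewrite tr_closed_loop// linearD/= trmxK addrC.
Qed.

(** With drift [A - 2^-1 *: (P *m S)] the quadratic term is absorbed, and the source is [R]. *)
Lemma riccati_psd A R S P : psd R -> S^T = S ->
  has_mxderiv P (fun t => riccati A R S (P t)) -> psd (P 0) ->
  forall t : K, 0 <= t -> psd (P t).
Proof.
move=> Rp ST PP' P0 t t0; have PT := riccati_sym Rp.1 ST PP' P0.1.
apply: (@lyapunov_psd _ _ P _ _ (fun=> R) t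
  (has_mxderiv_closed_loop A S PP' (has_mxderiv_cst 0))) => //; last first.
  by move=> s x _ _; exact: Rp.2.
apply: has_mxderiv_eq PP' _ => s s0; rewrite addr0.
rewrite tr_closed_loop ?addr0 ?PT ?ltW// /riccati; mxring.
Qed.

(** Only the excess of [X' - Y'] over the difference of Riccati fields matters: it is the source of
    the Lyapunov equation of [X - Y]. Both comparisons with the perturbed flow take this form. *)
Lemma riccati_comparison A R S X X' Y Y' (T : K) : S^T = S ->
  has_mxderiv X X' -> has_mxderiv Y Y' ->
  (forall t : K, 0 <= t -> (X t)^T = X t) ->
  (forall t : K, 0 <= t -> (Y t)^T = Y t) ->
  (forall t : K, 0 < t ->
     loewner (riccati A R S (X t) - riccati A R S (Y t)) (X' t - Y' t)) ->
  0 <= T -> loewner (Y 0) (X 0) -> loewner (Y T) (X T).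
Proof.
move=> ST XX' YY' XT YT XY T0 XY0.
pose G t := X' t - Y' t - (riccati A R S (X t) - riccati A R S (Y t)).
apply: (@lyapunov_psd _ _ (fun t => X t - Y t) _ _ G T
  (has_mxderiv_closed_loop A S XX' YY')) => //.
- apply: has_mxderiv_eq (has_mxderivB XX' YY') _ => s s0.
  rewrite /G riccatiB tr_closed_loop//; first by rewrite subrKC.
  by rewrite linearD/= XT ?YT ?ltW.
- by move=> t t0; rewrite linearB/= XT// YT.
- by move=> t x t0 _; exact: (XY t t0).2.
Qed.

Lemma psd_conj_invmx (M J Q : 'M[K]_n) : posdef M ->
  psd (J - (M *m Q *m M - M)) -> psd (invmx M + invmx M *m J *m invmx M - Q).
Proof.
move=> Mp /(psd_conj (invmx M)); have Mu := posdef_unitmx Mp.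
rewrite (posdef_invmx Mp).1 !mulmxBr !mulmxBl !mulmxA mulVmx// !mul1mx.
by rewrite mulmxK// opprB addrA [X in psd (X - _)]addrC.
Qed.

Lemma riccati_upper_bound A R S P (u : K) : S^T = S -> R^T = R ->
  psd S -> has_mxderiv P (fun t => riccati A R S (P t)) -> (P 0)^T = P 0 ->
  0 <= u -> posdef (obs_gramian A S u) ->
  loewner (P u) (invmx (obs_gramian A S u) + ctr_obs_gramian A R S u).
Proof.
move=> ST RT Sp PP' P0 u0 Op; have PT := riccati_sym RT ST PP' P0.
pose O := obs_gramian A S.
have OT t : (O t)^T = O t by rewrite /O obs_gramianE ctr_gramian_sym.
have O' : has_mxderiv O (fun t => - (A^T *m O t) - O t *m A + S).
  have h := has_mxderiv_ctr_gramian (- A^T) S; rewrite -obs_gramianE in h.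
  apply: (has_mxderiv_eq h) => t _.
  by rewrite [(- A^T)^T]linearN/= trmxK mulNmx mulmxN.
(* Conjugation by [E], which is the identity at time [u], cancels the drift of [O P O - O]. *)
pose E s := expmx (- (u - s) *: A).
have E' : has_mxderiv E (fun s => A *m E s).
  have := has_mxderiv_expmx_left A (- u) 1.
  have -> : (fun s => expmx ((- u + 1 * s) *: A)) = E.
    by apply/funext => s; rewrite /E mul1r opprB addrC.
  by move/has_mxderiv_eq; apply => s _; rewrite scale1r mul1r /E opprB addrC.
have EuE : E u = 1%:M by rewrite /E subrr oppr0 scale0r expmx0.
pose f s := (E s)^T *m O s *m R *m O s *m E s.
have fT s : (f s)^T = f s by rewrite /f !trmx_mul trmxK OT RT !mulmxA.
have [f' ff'] : exists f', has_mxderiv f f'.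
  eexists; exact: (has_mxderivM (has_mxderivM (has_mxderivMr R
    (has_mxderivM (has_mxderiv_tr E') O')) O') E').
pose J s := integralmx 0 s f.
have J' : has_mxderiv J f by exact: has_mxderiv_integralmx ff'.
(* The square discarded by the bound; it is the derivative of [J] minus the conjugated
   [O P O - O]. *)
pose G s := ((P s *m O s - 1%:M) *m E s)^T *m S *m ((P s *m O s - 1%:M) *m E s).
have Dp : psd (J u - (E u)^T *m (O u *m P u *m O u - O u) *m E u).
  apply: (@lyapunov_psd _ _
    (fun s => J s - (E s)^T *m (O s *m P s *m O s - O s) *m E s)
    (fun=> 0) _ G u (has_mxderiv_cst 0)) => //.
  - have h := has_mxderivB J' (has_mxderivM (has_mxderivM (has_mxderiv_tr E')
      (has_mxderivB (has_mxderivM (has_mxderivM O' PP') O') O')) E').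
    apply: (has_mxderiv_eq h) => s s0.
    rewrite /G /f trmx0 mul0mx mulmx0 !add0r !trmx_mul.
    rewrite [(P s *m O s - 1%:M)^T]linearB/= trmx_mul trmx1 OT PT ?ltW//.
    rewrite /riccati; mxring.
  - move=> t t0; rewrite linearB/= integralmx_sym// !trmx_mul trmxK.
    by rewrite linearB/= !trmx_mul OT PT// !mulmxA.
  - by move=> t x _ _; exact: (psd_conj _ Sp).2.
  - rewrite /J integralmx_point /O obs_gramianE ctr_gramian0.
    rewrite mulmx0 subr0 mulmx0 mul0mx subr0.
    split=> [|x]; first by rewrite trmx0.
    by rewrite mulmx0 mul0mx mxE.
rewrite EuE trmx1 mul1mx mulmx1 in Dp.
have fE : f = fun s => expmx (- (u - s) *: A^T) *m O s *m R *m O s *m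
                       expmx (- (u - s) *: A).
  by apply/funext => s; rewrite /f /E trmx_expmx.
have -> : ctr_obs_gramian A R S u = invmx (O u) *m J u *m invmx (O u).
  by rewrite /J fE.
exact: psd_conj_invmx Op Dp.
Qed.

(** The lower right block is [C *m N *m C], so conjugating by the column of blocks [1] and
    [- C^-1 N^-1] leaves exactly [Q - invmx N]. *)
Lemma psd_schur (Q C J : 'M[K]_n) :
  let N := invmx C *m J *m invmx C + invmx C in
  posdef C -> posdef N -> psd (block_mx Q C C (C + J)) ->
  psd (Q - invmx N).
Proof.
move=> N Cp Np; have Cu := posdef_unitmx Cp; have Nu := posdef_unitmx Np.
have -> : C + J = C *m N *m C.
  by rewrite /N mulmxDr mulmxDl !mulmxA mulmxV// !mul1mx mulmxKV// addrC.
move: Nu (posdef_invmx Np).1; clearbody N => Nu NiT.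
move=> /(psd_conj (col_mx 1%:M (- (invmx C *m invmx N)))).
rewrite tr_col_mx [(- _)^T]linearN/= trmx_mul NiT (posdef_invmx Cp).1 trmx1.
rewrite mul_row_block mul_row_col !mul1mx mulmx1 !mulNmx mulmxKV// !mulmxA.
by rewrite mulmxKV// mulVmx// mul1mx subrr mul0mx addr0.
Qed.

Lemma riccati_lower_bound A R S P (u : K) : psd R -> psd S ->
  has_mxderiv P (fun t => riccati A R S (P t)) -> psd (P 0) -> 0 <= u ->
  posdef (ctr_gramian A R u) -> posdef (obs_ctr_gramian A R S u) ->
  loewner (invmx (obs_ctr_gramian A R S u + invmx (ctr_gramian A R u))) (P u).
Proof.
move=> Rp Sp PP' P0 u0 Cp OCp; have PT := riccati_sym Rp.1 Sp.1 PP' P0.1.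
pose C := ctr_gramian A R.
have CT t : (C t)^T = C t by rewrite /C ctr_gramian_sym//; case: Rp.
have C' : has_mxderiv C _ := has_mxderiv_ctr_gramian A R.
pose E s := expmx ((u - s) *: A).
have E' : has_mxderiv E (fun s => - (E s *m A)).
  have := has_mxderiv_expmx_right A u (- 1).
  have -> : (fun s => expmx ((u + - 1 * s) *: A)) = E.
    by apply/funext => s; rewrite /E mulN1r.
  by move/has_mxderiv_eq; apply => s _; rewrite scaleN1r mulN1r.
have ET' := has_mxderiv_tr E'.
have EuE : E u = 1%:M by rewrite /E subrr scale0r expmx0.
pose f s := E s *m C s *m S *m C s *m (E s)^T.
have fT s : (f s)^T = f s by rewrite /f !trmx_mul trmxK CT Sp.1 !mulmxA.
have [f' ff'] : exists f', has_mxderiv f f'.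
  eexists; exact: (has_mxderivM (has_mxderivM (has_mxderivMr S
    (has_mxderivM E' C')) C') ET').
pose J s := integralmx 0 s f.
have J' : has_mxderiv J f by exact: has_mxderiv_integralmx ff'.
(* Conjugating the second block by [E] cancels its drift and brings out the
   integrand of [obs_ctr_gramian]. *)
pose B s := block_mx (P s) (C s *m (E s)^T) (E s *m C s)
  (E s *m C s *m (E s)^T + J s).
pose a s := block_mx (A - P s *m S) 0 0 (0 : 'M[K]_n).
(* [U] and [V] factor the source into two congruences, of [R] and of [S], which makes it positive
   semi-definite. *)
pose U s := row_mx 1%:M (E s)^T.
pose V s := row_mx (P s) (C s *m (E s)^T).
pose G s := (U s)^T *m R *m U s + (V s)^T *m S *m V s.
have [a' aa'] : exists a', has_mxderiv a a'.
  eexists; apply: has_mxderiv_block; try exact: has_mxderiv_cst.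
  apply: has_mxderivB; first exact: has_mxderiv_cst.
  by apply: has_mxderivMr; exact: PP'.
have Bp : psd (B u).
  apply: (@lyapunov_psd _ _ B a _ G u aa') => //.
  - have h := has_mxderiv_block PP' (has_mxderivM C' ET') (has_mxderivM E' C')
      (has_mxderivD (has_mxderivM (has_mxderivM E' C') ET') J').
    apply: (has_mxderiv_eq h) => s s0.
    rewrite /G /U /V !tr_row_mx [_ *m R]mul_col_mx [_ *m S]mul_col_mx.
    rewrite !mul_col_row.
    rewrite /a /B tr_block_mx !mulmx_block !trmx0 !add_block_mx.
    rewrite trmx1 !trmx_mul trmxK CT PT ?ltW//.
    rewrite [(- _)^T]linearN/= [(A - _)^T]linearB/= !trmx_mul Sp.1 PT ?ltW//.
    rewrite /riccati /f; congr block_mx; mxring.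
  - move=> t t0; rewrite /B tr_block_mx linearD/= integralmx_sym//.
    by rewrite !trmx_mul !trmxK CT PT// !mulmxA.
  - move=> t x _ _; rewrite qformD; apply: addr_ge0.
      exact: (psd_conj _ Rp).2.
    exact: (psd_conj _ Sp).2.
  (* At time [0] both the Gramian and [J] vanish, leaving [P 0] as the only nonzero block. *)
  - rewrite /B /C ctr_gramian0 /J integralmx_point !(mul0mx, mulmx0) addr0.
    split=> [|x]; first by rewrite tr_block_mx !trmx0 P0.1.
    rewrite -/(qform _ _) -[x]vsubmxK qform_block !(mulmx0, mul0mx) /qform.
    have O : (0 : 'M[K]_1) 0 0 = 0 by rewrite mxE.
    by rewrite !(mulmx0, mul0mx) !O !addr0; exact: P0.2.
rewrite /B EuE trmx1 !mulmx1 mul1mx in Bp.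
have fE : f = fun s => expmx ((u - s) *: A) *m C s *m S *m C s *m
                       expmx ((u - s) *: A^T).
  by apply/funext => s; rewrite /f /E trmx_expmx.
have OCE : obs_ctr_gramian A R S u = invmx (C u) *m J u *m invmx (C u).
  by rewrite /J fE.
rewrite OCE; rewrite OCE in OCp.
exact: (psd_schur Cp (posdefD OCp (posdef_psd (posdef_invmx Cp))) Bp).
Qed.

End Riccati.

(** * Trajectories of the flows and the spectral norm *)

Section Solutions.
Context {K : realType} (n : nat).
Implicit Types (F : 'M[K]_n -> 'M[K]_n) (P : K -> 'M[K]_n).

Lemma solves_has_mxderiv F Q P : solves F Q P ->
  has_mxderiv P (fun t => F (P t)).
Proof.
move=> [_ P0 Pd] i j; split=> [|t t0].
  have h : h^-1 * (P h i j - P 0 i j) @[h --> 0^'+] --> F (P 0) i j.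
    have := cvg_comp _ _ P0 (@coord_continuous K n n i j (F (P 0))).
    apply: cvg_trans; apply: near_eq_cvg; near=> h.
    by rewrite /= !mxE.
  have i0 : (h : K) @[h --> 0^'+] --> (0 : K).
    by apply: cvg_at_right_filter; exact: cvg_id.
  (* Right continuity at [0]: the increment is [x] times a quotient that converges. *)
  have H : x * (x^-1 * (P x i j - P 0 i j)) + P 0 i j @[x --> 0^'+] --> P 0 i j.
    rewrite -[X in _ --> X]add0r -[X in _ --> X + _](mul0r (F (P 0) i j)).
    by apply: cvgD; [apply: cvgM; [exact: i0|exact: h]|exact: cvg_cst].
  apply: cvg_trans H; apply: near_eq_cvg; near=> x.
  by rewrite /= mulVKf ?subrK//; near: x; exact: nbhs_right_neq.
have [dP eP] := Pd t t0.
have dPij := (derivable_mxP P t 1).1 dP i j.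
by apply: DeriveDef => //; rewrite -eP derive_mx// mxE.
Unshelve. all: by end_near. Qed.

(** Autonomy allows restarting at time [a], so a bound over a fixed window applies at every later
    time. *)
Lemma has_mxderiv_shift F P (a : K) : 0 <= a ->
  has_mxderiv P (fun t => F (P t)) ->
  has_mxderiv (fun s => P (a + s)) (fun s => F (P (a + s))).
Proof.
move=> a0 PP' i j; split=> [|t t0].
  rewrite addr0; apply/cvgrPdist_lt => e e0.
  have /cvgrPdist_lt/(_ e e0) := @has_mxderiv_cvg_right _ _ _ _ _ i j a PP' a0.
  by rewrite nbhs_right0P.
have at0 : 0 < a + t by rewrite ltr_wpDl.
have h1 : is_derive t 1 (fun s : K => a + s) 1.
  apply: (is_derive_eq (is_deriveD (is_derive_cst a t 1) (is_derive_id t 1))).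
  by rewrite add0r.
have := @is_derive1_comp _ (fun s => P s i j) (fun s : K => a + s) t _ _
  ((PP' i j).2 _ at0) h1.
by rewrite mulr1.
Qed.

(** For a unit vector [y], Cauchy-Schwarz bounds the form by the length of [M *m y], hence by the
    spectral norm; the general case follows by scaling. *)
Lemma loewner_spectral_norm (M : 'M[K]_n) w : M^T = M ->
  spectral_norm M <= w -> loewner M w%:M.
Proof.
move=> MT Mw; split=> [|x]; first by rewrite linearB/= tr_scalar_mx MT.
rewrite -/(qform _ x) qformB qform_scalar subr_ge0.
have [->|x0] := eqVneq x 0; first by rewrite /qform !mulmx0 mxE mulr0.
have q0 := qform1_gt0 x0; set q := qform _ x in q0 *.
pose s := Num.sqrt q.
have s0 : 0 < s by rewrite sqrtr_gt0.
have sE : s ^+ 2 = q by rewrite sqr_sqrtr// ltW.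
have qZ (N : 'M[K]_n) c y : qform N (c *: y) = c ^+ 2 * qform N y.
  rewrite /qform [(c *: y)^T]linearZ/= -!scalemxAl -scalemxAr scalerA mxE.
  by rewrite expr2.
pose y := s^-1 *: x.
have y1 : qform 1%:M y = 1 by rewrite qZ -/q -sE -exprMn mulVf ?expr1n ?gt_eqF.
have nE z : euclidean_norm z = Num.sqrt (qform 1%:M z).
  by rewrite /qform mulmx1.
have MM z : qform 1%:M (M *m z) = qform (M^T *m M) z.
  by rewrite -[M^T]mulmx1 qform_conj.
(* The supremum dominates its set only when the latter is bounded; a bound comes from the entries of
   [M^T *m M]. *)
have bnd : has_ubound
    [set euclidean_norm (M *m z) | z in [set z | euclidean_norm z <= 1]].
  pose c := \sum_i \sum_j `|(M^T *m M) i j|.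
  have c0 : 0 <= c by do 2 apply: sumr_ge0 => ? _.
  have Mc i j : `|(M^T *m M) i j| <= c.
    rewrite /c (bigD1 i)//= (bigD1 j)//= -addrA lerDl addr_ge0//.
      exact: sumr_ge0.
    by do 2 apply: sumr_ge0 => ? _.
  exists (Num.sqrt (c * n%:R)) => _ [z /= z1 <-].
  rewrite nE MM; apply: ler_wsqrtr.
  apply: (le_trans (ler_norm _)); apply: (le_trans (qform_bound z c0 Mc)).
  rewrite ler_piMr ?mulr_ge0//.
  by rewrite -(ler_sqrt (qform 1%:M z) ler01) sqrtr1 -nE.
have My : euclidean_norm (M *m y) <= w.
  have ub := ub_le_sup bnd; apply: le_trans Mw; apply: ub; exists y => //=.
  by rewrite nE y1 sqrtr1.
have yMy : qform M y <= w.
  apply: le_trans My; rewrite nE.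
  have p1 : psd (1%:M : 'M[K]_n) by apply/posdef_psd/posdef_scalar/ltr01.
  have := psd_cauchy_schwarz (M *m y) y p1.
  rewrite mulmx1 y1 mulr1 mulmxA -/(qform M y) => h.
  apply: (le_trans (ler_norm _)).
  by rewrite -sqrtr_sqr; exact: ler_wsqrtr.
have -> : x = s *: y by rewrite /y scalerA mulfV ?scale1r ?gt_eqF.
by rewrite qZ sE mulrC ler_pM2r.
Qed.

Lemma perturbed_riccatiE (pi : 'M[K]_n -> 'M[K]_n) (A R S Q : 'M[K]_n) :
  S^T = S -> (pi Q)^T = pi Q ->
  perturbed_riccati pi A R S Q =
  riccati A R S Q + (pi Q - Q) *m S *m (pi Q - Q).
Proof.
move=> ST piT; rewrite /perturbed_riccati /riccati.
rewrite [(A - _)^T]linearB/= trmx_mul ST piT; mxring.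
Qed.

End Solutions.

(** * Assembly of the chain of four inequalities *)

Theorem theorem2p4 (K : realType) (r r' : nat)
    (A R : 'M[K]_r) (C : 'M[K]_(r', r)) (Sigma : 'M[K]_r')
    (upsilon : K)
    (pi Rem : 'M[K]_r -> 'M[K]_r) (B0 B1 B2 : 'M[K]_r)
    (upsilon_pi wc_minus wc_plus wo_minus wo_plus : K)
    (phi phi_sup_pi phi_sub_pi : K -> 'M[K]_r -> 'M[K]_r) :
  let S := C^T *m invmx Sigma *m C in
  let varpi := sup [set spectral_norm (Rem Q) | Q in psd (n := r)] in
  let A_pi := A + B1 in
  let R_pi := R + B0 + varpi%:M in
  let S_pi := S - B2 in
  posdef R -> posdef Sigma ->
  controllable A (psd_sqrt R) -> observable A C ->
  obs_ctr_interval A R S upsilon ->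
  (forall Q, psd Q -> psd (pi Q)) ->
  B0^T = B0 -> B1^T = B1 -> B2^T = B2 -> loewner B2 S ->
  (forall Q, psd Q -> (Rem Q)^T = Rem Q) ->
  has_ubound [set spectral_norm (Rem Q) | Q in psd (n := r)] ->
  (forall Q, psd Q ->
     (pi Q - Q) *m S *m (pi Q - Q) =
     B0 + B1 *m Q + Q *m B1^T + Q *m B2 *m Q + Rem Q) ->
  0 < upsilon_pi ->
  0 < wc_minus -> 0 < wc_plus -> 0 < wo_minus -> 0 < wo_plus ->
  loewner wc_minus%:M (ctr_gramian A_pi R_pi upsilon_pi) ->
  loewner (ctr_gramian A_pi R_pi upsilon_pi) wc_plus%:M ->
  loewner wo_minus%:M (obs_gramian A_pi S_pi upsilon_pi) ->
  loewner (obs_gramian A_pi S_pi upsilon_pi) wo_plus%:M ->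
  flow (riccati A R S) phi ->
  unique_psd_flow (perturbed_riccati pi A R S) phi_sup_pi ->
  flow (riccati A_pi R_pi S_pi) phi_sub_pi ->
  forall (t : K) (Q : 'M[K]_r), Num.max upsilon upsilon_pi <= t -> psd Q ->
  [/\ loewner (invmx (obs_ctr_gramian A R S upsilon +
                      invmx (ctr_gramian A R upsilon)))
              (phi t Q),
      loewner (phi t Q) (phi_sup_pi t Q),
      loewner (phi_sup_pi t Q) (phi_sub_pi t Q) &
      loewner (phi_sub_pi t Q)
              (invmx (obs_gramian A_pi S_pi upsilon_pi) +
               ctr_obs_gramian A_pi R_pi S_pi upsilon_pi)].
Proof.
move=> S varpi A_pi R_pi S_pi Rpos Sigpos _ _ [u0 _ Cu _ OCu] pi_psd B0T B1T B2T.
move=> B2S RemT Rem_bnd Gamma upi0 _ _ wo0 _ _ _ Opi _.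
move=> phiF supF subF t Q; rewrite ge_max => /andP[ut upit] Qp.
have Sp : psd S by exact: psd_conj (posdef_psd (posdef_invmx Sigpos)).
have Rp := posdef_psd Rpos.
have psd0 : psd (0 : 'M[K]_r).
  by split=> [|x]; [rewrite trmx0|rewrite mulmx0 mul0mx mxE].
have Rem_le X : psd X -> loewner (Rem X) varpi%:M.
  move=> Xp; apply: loewner_spectral_norm; first exact: RemT.
  by have ub := ub_le_sup Rem_bnd; apply: ub; exists X.
(* The modified coefficients absorb the constant, linear and quadratic parts of the perturbation,
   leaving only the remainder against its bound. *)
have GammaE X : psd X -> riccati A_pi R_pi S_pi X -
    perturbed_riccati pi A R S X = varpi%:M - Rem X.
  move=> Xp; have [piT _] := pi_psd X Xp.
  rewrite perturbed_riccatiE ?Sp.1// Gamma//.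
  rewrite /riccati /A_pi /R_pi /S_pi [(A + B1)^T]linearD/=.
  move: (varpi%:M) => w; mxring.
(* At [Q = 0] the expansion reads [pi 0 *m S *m pi 0 = B0 + Rem 0], which exhibits [R_pi] as a sum
   of three positive semi-definite terms although [B0] has no sign. *)
have Rpip : psd R_pi.
  have [pi0T _] := pi_psd 0 psd0.
  have := Gamma 0 psd0; rewrite subr0 !(mulmx0, mul0mx) !addr0 => G0.
  have -> : R_pi = R + ((pi 0)^T *m S *m pi 0 + (varpi%:M - Rem 0)).
    by rewrite pi0T G0 /R_pi -!addrA subrKC.
  apply: psdD Rp (psdD (psd_conj _ Sp) (Rem_le 0 psd0)).
have t0 : 0 <= t by exact: le_trans (ltW u0) ut.
have dphi := solves_has_mxderiv (phiF Q Qp).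
have [[/solves_has_mxderiv dsup sup_psd] _] := supF Q Qp.
have dsub := solves_has_mxderiv (subF Q Qp).
have phi0 : phi 0 Q = Q by have [] := phiF Q Qp.
have sup0 : phi_sup_pi 0 Q = Q by have [[[]]] := supF Q Qp.
have sub0 : phi_sub_pi 0 Q = Q by have [] := subF Q Qp.
have phi_psd : forall s : K, 0 <= s -> psd (phi s Q).
  by apply: (riccati_psd Rp Sp.1 dphi); rewrite phi0.
have sub_sym : forall s : K, 0 <= s -> (phi_sub_pi s Q)^T = phi_sub_pi s Q.
  by apply: (riccati_sym Rpip.1 B2S.1 dsub); rewrite sub0; exact: Qp.1.
split.
(* The trajectory is restarted at [t - upsilon], where it is still positive semi-definite. *)
- have a0 : 0 <= t - upsilon by rewrite subr_ge0.
  have := riccati_lower_bound Rp Sp (has_mxderiv_shift a0 dphi).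
  rewrite addr0 => /(_ upsilon (phi_psd _ a0) (ltW u0)).
  rewrite subrK; apply.
    by have [c [_ [c0 _ h _]]] := Cu; exact: loewner_posdef c0 h.
  by have [c [_ [c0 _ h _]]] := OCu; exact: loewner_posdef c0 h.
(* Relative to the field of [(A, R, S)], which [phi] follows exactly, the excess is the perturbation
   along [phi_sup_pi]. *)
- apply: (@riccati_comparison _ _ A R S _ _ _ _ t Sp.1 dsup dphi) t0 _.
  + by move=> s s0; case: (sup_psd s s0).
  + by move=> s s0; case: (phi_psd s s0).
  + move=> s s0; have Xp := sup_psd s (ltW s0).
    have [piT _] := pi_psd _ Xp.
    have DE (a b c : 'M[K]_r) : a + b - c - (a - c) = b.
      by rewrite [a + b - c]addrAC [LHS]addrC addKr.
    rewrite /loewner /= perturbed_riccatiE ?Sp.1// DE.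
    set D := pi _ - _; have DT : D^T = D by rewrite linearB/= piT Xp.1.
    by rewrite -{1}DT; exact: psd_conj.
  + by rewrite phi0 sup0 /loewner subrr.
(* Here the reference field is the one followed by [phi_sub_pi], so the expansion is again evaluated
   only along [phi_sup_pi], known to stay positive semi-definite. *)
- apply: (@riccati_comparison _ _ A_pi R_pi S_pi _ _ _ _ t B2S.1 dsub dsup)
    t0 _ => //.
  + by move=> s s0; case: (sup_psd s s0).
  + move=> s s0; have Xp := sup_psd s (ltW s0).
    have DE (a b c : 'M[K]_r) : a - b - (a - c) = c - b.
      by rewrite opprB addrC subrKA.
    rewrite /loewner DE GammaE//.
    exact: Rem_le.
  + by rewrite sup0 sub0 /loewner subrr.
- have a0 : 0 <= t - upsilon_pi by rewrite subr_ge0.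
  have := riccati_upper_bound B2S.1 Rpip.1 B2S (has_mxderiv_shift a0 dsub).
  rewrite addr0 => /(_ upsilon_pi (sub_sym _ a0) (ltW upi0)).
  by rewrite subrK; apply; exact: loewner_posdef wo0 Opi.
Qed.
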